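(* Assume the setting and notation in the context, and suppose the selection threshold is exchangeable: $\hat\tau=\tau(T_i: i\in\mathcal C\cup\mathcal U)$ for a deterministic measurable function $\tau:\mathbb R^{n+m}\to\mathbb R$ that is invariant under all permutations of its $n+m$ arguments. Let $\hat{\mathcal S}_u=\{i\in\mathcal U: T_i\le\hat\tau\}$, $\hat{\mathcal S}_c=\{i\in\mathcal C: T_i\le\hat\tau\}$, and for $j\in\hat{\mathcal S}_u$ let $\mathrm{PI}^{\mathrm{SCOP}}_j=\big[\hat\mu(X_j)-Q_\alpha(\{R_i\}_{i\in\hat{\mathcal S}_c}),\ \hat\mu(X_j)+Q_\alpha(\{R_i\}_{i\in\hat{\mathcal S}_c})\big]$. Then: (i) for every $j\in\mathcal U$ with $\mathbb P(j\in\hat{\mathcal S}_u)>0$, $\mathbb P\big(Y_j\notin \mathrm{PI}^{\mathrm{SCOP}}_j\mid j\in\hat{\mathcal S}_u\big)\le\alpha$; (ii) $\mathrm{FCR}\le\alpha$ for these intervals; (iii) if moreover the residuals $\{R_i\}_{i\in\mathcal C\cup\mathcal U}$ are almost surely pairwise distinct and $\mathbb P(|\hat{\mathcal S}_u|>0)=1$, then $\mathrm{FCR}\ge\alpha-\mathbb E\big[(|\hat{\mathcal S}_c|+1)^{-1}\big]$.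
   Context: Setting: $\hat\mu:\mathbb R^d\to\mathbb R$ (prediction model) and $g:\mathbb R^d\to\mathbb R$ (selection score) are fixed deterministic measurable functions (obtained from a training set that is treated as fixed). The calibration indices form a set $\mathcal C$ with $|\mathcal C|=n$ and the test indices a disjoint set $\mathcal U$ with $|\mathcal U|=m$. The pairs $(X_i,Y_i)\in\mathbb R^d\times\mathbb R$, $i\in\mathcal C\cup\mathcal U$, are independent and identically distributed; test labels are unobserved by the procedure. Define scores $T_i=g(X_i)$ and residuals $R_i=|Y_i-\hat\mu(X_i)|$. Fix $\alpha\in(0,1)$. For a finite index set $S$, $Q_\alpha(\{R_i\}_{i\in S})$ denotes the $\lceil(1-\alpha)(|S|+1)\rceil$-th smallest value of $\{R_i\}_{i\in S}$, with the convention that it equals $+\infty$ if $\lceil(1-\alpha)(|S|+1)\rceil>|S|$ (in particular if $S=\emptyset$). For a selected test set $\hat{\mathcal S}_u$ with intervals $\mathrm{PI}_j$, $j\in\hat{\mathcal S}_u$, the false coverage-statement rate is $\mathrm{FCR}=\mathbb E\Big[\frac{|\{j\in\hat{\mathcal S}_u: Y_j\notin\mathrm{PI}_j\}|}{\max\{|\hat{\mathcal S}_u|,1\}}\Big]$. *)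

(* Defs.v *)
From HB Require Import structures.
From mathcomp Require Import all_boot all_order all_algebra all_fingroup.
From mathcomp Require Import all_classical all_reals all_analysis.

Set Implicit Arguments.
Unset Strict Implicit.
Unset Printing Implicit Defensive.

Import Order.TTheory GRing.Theory Num.Theory.
Local Open Scope classical_set_scope.
Local Open Scope ring_scope.

Definition Qalpha (R : realType) (N : nat) (alpha : R) (r : 'I_N -> R)
    (S : {set 'I_N}) : \bar R :=
  let k := Num.ceil ((1 - alpha) * (#|S|.+1)%:R) in
  if (#|S|%:Z < k)%R then +oo%E
  else (nth 0 (sort <=%R [seq r i | i <- enum S]) (`|k|%N.-1))%:E.

Definition in_PI (R : realType) (c : R) (q : \bar R) (y : R) : bool :=
  ((c%:E - q)%E <= y%:E)%E && (y%:E <= (c%:E + q))%E.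

Definition mutually_independent (R : realType) (d : measure_display)
    (Omega : measurableType d) (P : probability Omega R)
    (dY : measure_display) (Yt : measurableType dY) (N : nat)
    (Z : 'I_N -> Omega -> Yt) : Prop :=
  forall B : 'I_N -> set Yt, (forall i, measurable (B i)) ->
    P (\bigcap_(i in [set: 'I_N]) (Z i @^-1` B i)) =
    (\prod_(i < N) P (Z i @^-1` B i))%E.

Definition identically_distributed (R : realType) (d : measure_display)
    (Omega : measurableType d) (P : probability Omega R)
    (dY : measure_display) (Yt : measurableType dY) (N : nat)
    (Z : 'I_N -> Omega -> Yt) : Prop :=
  forall (i j : 'I_N) (B : set Yt), measurable B ->
    P (Z i @^-1` B) = P (Z j @^-1` B).

Definition cond_prob (R : realType) (d : measure_display)
    (Omega : measurableType d) (P : probability Omega R)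
    (A B : set Omega) : R :=
  fine (P (A `&` B)) / fine (P B).

(* Main.v *)
(* All quantities depend on the sample only through its configuration: the set
   of indices that pass the threshold, and the order relation between residuals.
   The configuration has a law on a finite set, invariant under permutations of
   the indices because the data are iid and the threshold is symmetric.

   Fix a test index j and let W consist of j and the selected calibration
   indices.  If j is selected, exchanging j with some k in W leaves both
   selected sets unchanged, and after the exchange j is missed iff at least
   K = ceil((1 - alpha) |W|) residuals in W lie strictly below that of k.
   Averaging over k in W, the miss probability becomes the expected fraction of
   such k; their number is at most |W| - K, with equality for distinct residuals.
   All of this can be weighted by a function of the whole selected set: the
   weight 1 gives (i), and 1 / max(|S_u|, 1), summed over j, gives (ii), (iii). *)

Require Import Defs.
From HB Require Import structures.
From mathcomp Require Import all_boot all_order all_algebra all_fingroup.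
From mathcomp Require Import all_classical all_reals all_analysis.
From mathcomp Require Import measurable_realfun ring lra.

Import Order.TTheory GRing.Theory Num.Theory.
Local Open Scope classical_set_scope.
Local Open Scope ring_scope.

(** * Order statistics expressed by counting *)

(** In sorted order the first [K] entries are at most the [K]-th one and the later entries are at
    least as large. The index is [K.-1] because ranks start at 1 and positions at 0. *)
Lemma nth_sort_lt (R : realDomainType) (s : seq R) (K : nat) (x : R) :
  (0 < K)%N -> (K <= size s)%N ->
  (nth 0 (sort <=%R s) K.-1 < x) = (K <= count (fun y => (y < x)%R) s)%N.
Proof.
case: K => // K _ Ks; have {Ks} := Ks; rewrite /= -(size_sort <=%R s).
rewrite -(seq.permP (permEl (perm_sort <=%R s))).
have := sort_le_sorted s; move: (sort _ _) => t st Kt.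
have le_t i : (i < size t)%N -> (i <= K)%N -> nth 0 t i <= nth 0 t K.
  by move=> it iK; apply: (sorted_leq_nth le_trans lexx); rewrite ?inE.
apply/idP/idP => [tx|].
  rewrite -(cat_take_drop K.+1 t) count_cat.
  suff -> : count (fun y => y < x) (take K.+1 t) = K.+1 by rewrite leq_addr.
  rewrite -{2}(size_takel Kt); apply/eqP; rewrite -all_count.
  apply/(all_nthP 0) => i; rewrite size_takel// => iK; rewrite nth_take//.
  by apply: le_lt_trans tx; apply: le_t => //; exact: leq_trans Kt.
apply: contraTT; rewrite -leNgt -ltnNge => xt.
rewrite -(cat_take_drop K t) count_cat.
suff -> : count (fun y => y < x) (drop K t) = 0%N.
  by rewrite addn0 (leq_ltn_trans (count_size _ _))// size_take Kt.
apply/eqP; rewrite -leqn0 leqNgt -has_count -all_predC.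
apply/(all_nthP 0) => i; rewrite size_drop nth_drop /= ltn_subRL => ilt.
rewrite -leNgt (le_trans xt)//.
by apply: (sorted_leq_nth le_trans lexx); rewrite ?inE ?leq_addr.
Qed.

(** Only the entries placed after the [K]-th in sorted order can exceed it; without ties all of them
    do. *)
Lemma count_gt_nth_sort (R : realDomainType) (s : seq R) (K : nat) :
  (0 < K)%N -> (K <= size s)%N ->
  let x := nth 0 (sort <=%R s) K.-1 in
  (count (fun y => (x < y)%R) s <= size s - K)%N /\
  (uniq s -> count (fun y => (x < y)%R) s = (size s - K)%N).
Proof.
case: K => // K _ Ks /=; have {Ks} := Ks; rewrite /= -(size_sort <=%R s).
rewrite -(seq.permP (permEl (perm_sort <=%R s))).
rewrite -(perm_uniq (permEl (perm_sort <=%R s))).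
have := sort_le_sorted s; move: (sort _ _) => t st Kt.
have -> : count (fun y => t`_K < y) t = count (fun y => t`_K < y) (drop K.+1 t).
  rewrite -{2}(cat_take_drop K.+1 t) count_cat.
  suff -> : count (fun y => t`_K < y) (take K.+1 t) = 0%N by [].
  apply/eqP; rewrite -leqn0 leqNgt -has_count -all_predC.
  apply/(all_nthP 0) => i; rewrite size_takel//= => iK.
  rewrite nth_take// -leNgt; apply: (sorted_leq_nth le_trans lexx);
    by rewrite ?inE//; exact: leq_trans Kt.
rewrite -size_drop count_size; split=> // ut.
apply/eqP; rewrite -all_count; apply/(all_nthP 0) => i.
rewrite size_drop nth_drop ltn_subRL => iK.
have Ki : (K < K.+1 + i)%N by rewrite ltnS leq_addr.
rewrite lt_neqAle nth_uniq// neq_ltn Ki/=.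
by apply: (sorted_leq_nth le_trans lexx); rewrite ?inE// ltnW.
Qed.

(** * The conformal rank and the miss criterion *)

(** The rank used in [Qalpha], as a natural number. For [alpha < 1] the ceiling is positive, so the
    absolute value changes nothing. *)
Definition qrank {R : realType} (alpha : R) (s : nat) : nat :=
  `|Num.ceil ((1 - alpha) * s.+1%:R)|%N.

Lemma qrank_gt0 (R : realType) (alpha : R) s : alpha < 1 -> (0 < qrank alpha s)%N.
Proof.
move=> a1; rewrite /qrank absz_gt0 gt_eqF// ceil_gt0 mulr_gt0//.
by rewrite subr_gt0.
Qed.

Lemma qrankE (R : realType) (alpha : R) s : alpha < 1 ->
  (qrank alpha s)%:Z = Num.ceil ((1 - alpha) * s.+1%:R).
Proof.
move=> a1; rewrite /qrank gez0_abs// ceil_ge0.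
by rewrite (@lt_le_trans _ _ 0)// mulr_ge0// subr_ge0 ltW.
Qed.

(** A miss means that the residual exceeds an order statistic, which is a counting condition. When
    the quantile is infinite, the rank is larger than [#|S|] and no count can reach it, so both
    sides are false. *)
Lemma not_in_PI_Qalpha (R : realType) (N : nat) (alpha c y : R) (r : 'I_N -> R)
    (S : {set 'I_N}) : alpha < 1 ->
  ~~ in_PI c (Qalpha alpha r S) y =
  (qrank alpha #|S| <= #|[set i in S | (r i < `|y - c|)%R]|)%N.
Proof.
move=> a1; rewrite /Qalpha -/(qrank alpha #|S|) -qrankE// ltz_nat /=.
case: ltnP => [SK|KS].
  rewrite /in_PI /= addeC /= leNye leey /=; apply/esym/negbTE.
  rewrite -ltnNge (leq_ltn_trans _ SK)// subset_leq_card//.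
  by apply/fintype.subsetP => i; rewrite inE => /andP[].
have szE : size [seq r i | i <- enum S] = #|S| by rewrite size_map -cardE.
rewrite /in_PI !lee_fin.
set q := nth _ _ _.
have -> : (c - q <= y) && (y <= c + q) = (`|y - c| <= q).
  by rewrite ler_norml lerBrDl (lerBlDl y).
rewrite -ltNge /q nth_sort_lt ?qrank_gt0 ?szE//; congr (_ <= _)%N.
rewrite count_map -size_filter cardE; congr size.
by rewrite {2}/enum_mem -filter_predI; apply: eq_filter => i; rewrite !inE andbC.
Qed.

(** Having at least [K] members of [W] strictly below amounts to exceeding the [K]-th smallest
    value. If [W] has fewer than [K] elements the set is empty, in agreement with truncated
    subtraction. *)
Lemma card_rank_ge (R : realDomainType) (I : finType) (r : I -> R)
    (W : {set I}) (K : nat) : (0 < K)%N ->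
  let A := [set k in W | (K <= #|[set i in W | (r i < r k)%R]|)%N] in
  (#|A| <= #|W| - K)%N /\ ({in W &, injective r} -> #|A| = (#|W| - K)%N).
Proof.
move=> K0 A.
have card_count (p : pred R) : #|[set i in W | p (r i)]| = count p (map r (enum W)).
  rewrite count_map -size_filter cardE; congr size.
  by rewrite {1}/enum_mem -filter_predI; apply: eq_filter => i; rewrite !inE andbC.
have szE : size (map r (enum W)) = #|W| by rewrite size_map -cardE.
case: (leqP K #|W|) => [KW|WK].
  pose x := nth 0 (sort <=%R (map r (enum W))) K.-1.
  have -> : A = [set k in W | x < r k].
    apply/setP => k; rewrite !inE (card_count (fun y => y < r k)).
    by rewrite -nth_sort_lt ?szE.
  rewrite (card_count (fun y => x < y)).
  have [|le_c eq_c] := @count_gt_nth_sort _ (map r (enum W)) K K0; first by rewrite szE.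
  split; first by rewrite -szE.
  move=> rI; rewrite -szE; apply: eq_c.
  by rewrite map_inj_in_uniq ?enum_uniq// => i j; rewrite !mem_enum; apply: rI.
suff -> : A = finset.set0.
  by rewrite cards0; split=> // _; symmetry; apply/eqP; rewrite subn_eq0 ltnW.
apply/setP => k; rewrite !inE; apply/negbTE; rewrite negb_and -ltnNge.
rewrite (leq_ltn_trans _ WK) ?orbT// subset_leq_card//.
by apply/fintype.subsetP => i; rewrite inE => /andP[].
Qed.

(** With [K = qrank alpha s], the ceiling satisfies [x <= K < x + 1] for [x = (1 - alpha)(s + 1)];
    both bounds follow on dividing [s + 1 - K] by [s + 1]. *)
Lemma rank_ratio_bounds (R : realType) (I : finType) (r : I -> R)
    (W : {set I}) (s : nat) (alpha : R) : 0 < alpha < 1 -> #|W| = s.+1 ->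
  let A := [set k in W | (qrank alpha s <= #|[set i in W | (r i < r k)%R]|)%N] in
  #|A|%:R / s.+1%:R <= alpha /\
  ({in W &, injective r} -> alpha - s.+1%:R^-1 <= #|A|%:R / s.+1%:R).
Proof.
move=> /andP[a0 a1] Ws A.
have [le_A eq_A] := card_rank_ge _ _ r W _ (qrank_gt0 _ alpha s a1).
rewrite -/A Ws in le_A eq_A.
have s0 : 0 < s.+1%:R :> R by [].
set x := (1 - alpha) * s.+1%:R.
have qE : (qrank alpha s)%:R = (Num.ceil x)%:~R :> R by rewrite -qrankE.
have q_ge : x <= (qrank alpha s)%:R by rewrite qE ceil_ge.
have q_lt : (qrank alpha s)%:R < x + 1.
  by rewrite qE -ltrBlDr -[1]/(1%:~R) -intrB gt_pred_ceil ?num_real.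
(* This makes the truncated difference [s.+1 - qrank alpha s] a true one. *)
have qs : (qrank alpha s <= s.+1)%N.
  rewrite -ltnS -(ltr_nat R) (lt_trans q_lt)// -[s.+2%:R]natr1 ltrD2r.
  by rewrite /x mulrBl mul1r gtrBl mulr_gt0.
rewrite /x mulrBl mul1r in q_ge q_lt; split.
  rewrite ler_pdivrMr// (@le_trans _ _ (s.+1 - qrank alpha s)%:R) ?ler_nat//.
  by rewrite natrB//; lra.
move=> rI; rewrite ler_pdivlMr// mulrBl mulVf ?gt_eqF// eq_A//.
by rewrite natrB//; lra.
Qed.

(** * Exchanging two indices in a configuration *)

Definition conf_act {I : finType} (t : {perm I}) (c : {set I} * {set I * I}) :
    {set I} * {set I * I} :=
  ([set i | t i \in c.1], [set u | (t u.1, t u.2) \in c.2])%SET.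

(* On the event [j \in c.1], the transposition of [j] and [k] fixes [c.1] when
   [k] lies in [W c.1]; each [k] then contributes through its own rank. *)
Lemma swap_sum (R : numFieldType) (I : finType) (C : {set I}) (j : I)
    (p : {set I} * {set I * I} -> R) (h : {set I} -> R) (K : nat -> nat) :
  j \notin C -> (forall t c, p (conf_act t c) = p c) ->
  let W := fun S : {set I} => j |: (C :&: S) in
  \sum_c p c * h c.1 * (j \in c.1)%:R *
     (K #|C :&: c.1| <= #|[set i in C :&: c.1 | (i, j) \in c.2]|)%N%:R =
  \sum_c p c * h c.1 * (j \in c.1)%:R *
     (#|[set k in W c.1 |
         (K #|C :&: c.1| <= #|[set i in W c.1 :\ k | (i, k) \in c.2]|)%N]|%:R
       / #|C :&: c.1|.+1%:R).
Proof.
move=> jC p_inv W.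
have cardW S : #|W S| = #|C :&: S|.+1 by rewrite cardsU1 inE (negbTE jC).
pose m (c : {set I} * {set I * I}) :=
  (K #|C :&: c.1| <= #|[set i in C :&: c.1 | (i, j) \in c.2]|)%N.
pose m' k (c : {set I} * {set I * I}) :=
  (K #|C :&: c.1| <= #|[set i in W c.1 :\ k | (i, k) \in c.2]|)%N.
pose q (c : {set I} * {set I * I}) := p c * h c.1 / #|C :&: c.1|.+1%:R.
have eL c : p c * h c.1 * (j \in c.1)%:R * (m c)%:R =
    \sum_k q c * ((j \in c.1) && (k \in W c.1) && m c)%:R.
  (* Each term is cut into [#|W c.1|] equal shares, one for each [k] in [W c.1]. *)
  transitivity (\sum_(k in W c.1) q c * ((j \in c.1) && m c)%:R).
    rewrite sumr_const cardW -[RHS]mulr_natr /q [RHS]mulrAC mulfVK ?pnatr_eq0//.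
    by rewrite -!mulrA -natrM mulnb.
  rewrite big_mkcond/=; apply: eq_bigr => k _.
  by case: (k \in W _); rewrite ?andbT ?andbF ?mulr0.
have eR c : p c * h c.1 * (j \in c.1)%:R *
      (#|[set k in W c.1 | m' k c]|%:R / #|C :&: c.1|.+1%:R) =
    \sum_k q c * ((j \in c.1) && (k \in W c.1) && m' k c)%:R.
  transitivity (\sum_(k in [set k in W c.1 | m' k c]) q c * (j \in c.1)%:R).
    by rewrite sumr_const -[RHS]mulr_natr /q; ring.
  rewrite big_mkcond/=; apply: eq_bigr => k _; rewrite inE.
  by case: (k \in W _); case: (m' k c); rewrite ?andbT ?andbF ?mulr0.
rewrite (eq_bigr _ (fun c _ => eL c)) (eq_bigr _ (fun c _ => eR c)).
rewrite exchange_big [RHS]exchange_big/=; apply: eq_bigr => k _.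
pose t := tperm j k.
have actK : involutive (conf_act t).
  by case=> S r; congr pair; apply/setP => u; rewrite !inE !tpermK//; case: u.
rewrite (reindex_inj (inv_inj actK)); apply: eq_bigr => -[S r] _ /=.
(* For [k] distinct from [j] the condition says that [k] is in [C] and that both [j] and [k] are
   selected, which is symmetric under the exchange. *)
have -> : (j \in (conf_act t (S, r)).1) && (k \in W (conf_act t (S, r)).1) =
          (j \in S) && (k \in W S).
  rewrite !inE /= tpermL tpermR; case: (eqVneq k j) => [->|_] /=; first by rewrite !andbT.
  by case: (j \in S); case: (k \in S); rewrite ?andbT ?andbF.
case: (boolP ((j \in S) && (k \in W S))) => [|_]; last by rewrite !mulr0.
move=> /andP[jS kW].
have ES : (conf_act t (S, r)).1 = S.
  have kS : k \in S by move: kW; rewrite !inE => /orP[/eqP->|/andP[]].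
  by apply/setP => i; rewrite !inE /=; case: tpermP => [->|->|]; rewrite ?jS ?kS.
have -> : q (conf_act t (S, r)) = q (S, r) by rewrite /q p_inv ES.
rewrite /m /m' ES /=.
congr (_ * (nat_of_bool (_ <= _)%N)%:R).
(* The transposition carries [W S :\ k] onto [W S :\ j], which is [C :&: S]. *)
rewrite -(card_preimset _ (@perm_inj _ t)).
apply: eq_card => i; rewrite !inE.
rewrite /= tpermK tpermL; congr (_ && _); move: kW; rewrite !inE /t.
case: (tpermP j k i) => [->|->|/eqP/negbTE-> /eqP/negbTE->//].
  rewrite eqxx (eq_sym j); case: eqVneq => [->|_ /= /andP[-> ->]//].
  by rewrite (negbTE jC).
by rewrite (negbTE jC) eqxx.
Qed.

(** * Exchangeability of an iid sample *)

Section iid.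
Context {R : realType} {dO : measure_display} {Omega : measurableType dO}
  {P : probability Omega R} {dY : measure_display} {Yt : measurableType dY}
  {N : nat} {Z : 'I_N -> Omega -> Yt}.
Hypothesis mZ : forall i, measurable_fun setT (Z i).
Hypothesis indep : mutually_independent P Z.
Hypothesis ident : identically_distributed P Z.

Let Zt (s : 'S_N) (w : Omega) : N.-tuple Yt := [tuple Z (s i) w | i < N].

Let mZt s : measurable_fun setT (Zt s).
Proof.
apply/measurable_fun_tnthP => i.
by apply: (eq_measurable_fun (Z (s i))) => // w _ /=; rewrite tnth_mktuple.
Qed.

Let rect (B : 'I_N -> set Yt) : set (N.-tuple Yt) :=
  \bigcap_(i in [set: 'I_N]) ((@tnth _ Yt ^~ i) @^-1` B i).

(** Permuting the sample amounts to permuting the sides of the rectangle; by independence this only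
    reorders the factors, and equal marginals remove the dependence on [s]. *)
Let prob_rect s B : (forall i, measurable (B i)) ->
  P (Zt s @^-1` rect B) = (\prod_(i < N) P (Z i @^-1` B i))%E.
Proof.
move=> mB.
have -> : Zt s @^-1` rect B =
    \bigcap_(i in [set: 'I_N]) (Z i @^-1` B (s^-1%g i)).
  apply/seteqP; split=> w /= Bw i _ /=.
    by have := Bw (s^-1%g i) I; rewrite /= tnth_mktuple permKV.
  by rewrite tnth_mktuple; have := Bw (s i) I; rewrite /= permK.
rewrite indep// (reindex_inj (@perm_inj _ s))/=.
by apply: eq_bigr => i _; rewrite permK; exact: ident.
Qed.

(** The laws of the permuted and original samples agree on rectangles, which form a generating
    system closed under intersection, hence on all measurable sets. *)
Lemma iid_exchangeable (s : 'S_N) (A : set (N.-tuple Yt)) : measurable A ->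
  P [set w | A [tuple Z (s i) w | i < N]] = P [set w | A [tuple Z i w | i < N]].
Proof.
move=> mA.
pose G := [set rect B | B in [set B | forall i, measurable (B i)]].
have rectT : rect (fun=> setT) = setT by apply/seteqP; split.
(* A coordinate cylinder is a rectangle whose other sides are full, and a rectangle is a finite
   intersection of cylinders. *)
have mG : measurable = <<s G >>.
  apply/seteqP; split; apply: smallest_sub; try exact: smallest_sigma_algebra.
  - rewrite -bigcup_seq; apply: bigcup_sub => i _ _ [B mB <-].
    apply: sub_sigma_algebra; exists (fun k => if k == i then B else setT).
      by move=> k; case: ifP.
    rewrite setTI; apply/seteqP; split=> z /=.
      by move=> /(_ i I) /=; rewrite eqxx.
    by move=> Bz k _ /=; case: eqP => [->|].
  - move=> _ [B mB <-]; apply: fin_bigcap_measurable => // i _.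
    by rewrite -[X in measurable X]setTI; exact: measurable_tnth.
have -> : [set w | A [tuple Z i w | i < N]] = Zt 1%g @^-1` A.
  apply/seteqP; split=> w /=; congr A; apply: eq_mktuple => i;
  by rewrite perm1.
rewrite -/(Zt s @^-1` A).
apply: (@measure_unique _ _ _ G (fun=> setT) mG _ _ _
  (pushforward P (Zt s)) (pushforward P (Zt 1%g))) => //.
- move=> _ _ [B mB <-] [B' mB' <-]; exists (fun i => B i `&` B' i).
    by move=> i; exact: measurableI.
  apply/seteqP; split=> z /= Bz.
    by split=> i /Bz [].
  by case: Bz => Bz Bz' i Ii; split; [exact: Bz|exact: Bz'].
- by move=> _; exists (fun=> setT).
- exact: bigcup_const.
- by move=> _ [B mB <-]; exact: etrans (prob_rect s B mB) (esym (prob_rect 1%g B mB)).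
- by move=> _; change (P setT < +oo)%E; rewrite probability_setT ltry.
Qed.

End iid.

(** * Random elements of a finite set *)

Section discrete.
Context {R : realType} {dO : measure_display} {Omega : measurableType dO}
  {P : probability Omega R} {J : finType} {f : Omega -> J}.
Hypothesis mf : forall c, measurable (f @^-1` [set c]).

(** The integrand is a finite combination of indicators of the fibres of [f]. *)
Lemma integral_discrete (F : J -> R) : (forall c, 0 <= F c) ->
  (\int[P]_w (F (f w))%:E = (\sum_c fine (P (f @^-1` [set c])) * F c)%:E)%E.
Proof.
move=> F0.
have -> : (\int[P]_w (F (f w))%:E =
    \int[P]_w \sum_(c : J) ((F c)%:E * (\1_(f @^-1` [set c]) w)%:E))%E.
  apply: eq_integral => w _.
  rewrite (bigD1 (f w))//= big1 => [|c cf].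
    by rewrite indicE mem_set// mule1 adde0.
  by rewrite indicE memNset ?mule0// => /= e; rewrite e eqxx in cf.
rewrite ge0_integral_sum//; last 2 first.
- by move=> c; apply: measurable_funeM; apply/measurable_EFinP; exact: measurable_indic.
- by move=> c w _; rewrite mule_ge0// lee_fin.
rewrite -sumEFin; apply: eq_bigr => c _.
rewrite ge0_integralZl ?lee_fin//; last first.
  by apply/measurable_EFinP; exact: measurable_indic.
by rewrite integral_indic// setIT EFinM muleC fineK ?fin_num_measure.
Qed.

Lemma probability_discrete (b : pred J) :
  P [set w | b (f w)] = (\sum_c fine (P (f @^-1` [set c])) * (b c)%:R)%:E.
Proof.
have mb : measurable [set w | b (f w)].
  have -> : [set w | b (f w)] = \bigcup_(c in [set c | b c]) (f @^-1` [set c]).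
    by apply/seteqP; split=> [w /= bw|w [c /= bc ->]//]; exists (f w).
  by apply: fin_bigcup_measurable => // c _; exact: mf.
have := integral_discrete (fun c => (b c)%:R : R) (fun c => ler0n _ _).
move=> <-; rewrite -[LHS]/(P _) -[X in P X]setIT -integral_indic//.
apply: eq_integral => w _; rewrite indicE; congr ((nat_of_bool _)%:R%:E).
by apply/idP/idP => [|bw]; rewrite inE.
Qed.

End discrete.

Lemma measurable_set_valued (d : measure_display) (T : measurableType d)
    (I : finType) (F : T -> {set I}) (S : {set I}) :
  (forall i, measurable_fun setT (fun x => i \in F x)) ->
  measurable (F @^-1` [set S]).
Proof.
move=> mF.
have -> : F @^-1` [set S] =
    \bigcap_(i in [set: I]) ((fun x => i \in F x) @^-1` [set i \in S]).
  apply/seteqP; split=> [x /= <- i _ //|x Fx]; apply/setP => i; exact: (Fx i Logic.I).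
apply: fin_bigcap_measurable => [|i _]; first exact: finite_finset.
by rewrite -[X in measurable X]setTI; exact: mF.
Qed.

(** * The law of the configuration and its permutation invariance *)

Section configuration.
Context {R : realType} {dO : measure_display} {Omega : measurableType dO}
  {P : probability Omega R} {dY : measure_display} {Yt : measurableType dY}
  {N : nat} {Z : 'I_N -> Omega -> Yt}.
Hypothesis mZ : forall i, measurable_fun setT (Z i).
Hypothesis indep : mutually_independent P Z.
Hypothesis ident : identically_distributed P Z.
Context {T r : Yt -> R} {tau : N.-tuple R -> R}.
Hypotheses (mT : measurable_fun setT T) (mr : measurable_fun setT r).
Hypothesis mtau : measurable_fun setT tau.
Hypothesis tau_sym : forall (s : 'S_N) (t : N.-tuple R),
  tau [tuple tnth t (s i) | i < N] = tau t.

(* [r i < r k] for all pairs determines every rank, hence every miss event. *)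
Definition configuration (z : N.-tuple Yt) : {set 'I_N} * {set 'I_N * 'I_N} :=
  ([set i | T (tnth z i) <= tau [tuple T (tnth z k) | k < N]],
   [set u | r (tnth z u.1) < r (tnth z u.2)])%SET.

Let conf (w : Omega) := configuration [tuple Z i w | i < N].

(** The symmetry of [tau] keeps the threshold fixed, so permuting the sample merely relabels
    indices. *)
Lemma configuration_perm (s : 'S_N) w :
  configuration [tuple Z (s i) w | i < N] = conf_act s (conf w).
Proof.
congr pair; apply/setP => i; rewrite !inE !tnth_mktuple//.
rewrite -[in RHS](tau_sym s); congr (_ <= tau _).
by apply: eq_mktuple => k; rewrite !tnth_mktuple.
Qed.

Lemma measurable_configuration c : measurable (configuration @^-1` [set c]).
Proof.
have mTz i : measurable_fun setT (fun z : N.-tuple Yt => T (tnth z i)).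
  by apply: measurableT_comp => //; exact: measurable_tnth.
have mrz i : measurable_fun setT (fun z : N.-tuple Yt => r (tnth z i)).
  by apply: measurableT_comp => //; exact: measurable_tnth.
have -> : configuration @^-1` [set c] =
    (fst \o configuration) @^-1` [set c.1] `&`
    (snd \o configuration) @^-1` [set c.2].
  move: configuration => F; apply/seteqP; split=> z /=; first by move=> <-.
  by case: (F z) c => [a b] [a' b'] [/= -> ->].
apply: measurableI; apply: measurable_set_valued => i.
- under eq_fun do rewrite inE.
  apply: measurable_fun_ler => //; apply: measurableT_comp => //.
  apply/measurable_fun_tnthP => k.
  by apply: (eq_measurable_fun (fun z => T (tnth z k))) => // z _ /=;
     rewrite tnth_mktuple.
- under eq_fun do rewrite inE.
  exact: measurable_fun_ltr.
Qed.

Lemma measurable_conf c : measurable (conf @^-1` [set c]).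
Proof.
have mZt : measurable_fun setT (fun w => [tuple Z i w | i < N]).
  apply/measurable_fun_tnthP => i.
  by apply: (eq_measurable_fun (Z i)) => // w _ /=; rewrite tnth_mktuple.
rewrite -[X in measurable X]setTI; exact: (mZt _ _ (measurable_configuration c)).
Qed.

Let p c : R := fine (P (conf @^-1` [set c])).

(** By exchangeability the sample may be permuted by [s], which applies [conf_act s] to the
    configuration; injectivity of this action then cancels it. *)
Lemma conf_law_perm (s : 'S_N) c : p (conf_act s c) = p c.
Proof.
have actI : injective (conf_act s).
  move=> [A B] [A' B'] [/setP eA /setP eB]; congr pair; apply/setP => i.
    by have := eA (s^-1%g i); rewrite !inE permKV.
  case: i => i k.
  by have := eB (s^-1%g i, s^-1%g k); rewrite !inE /= !permKV.
rewrite /p; congr fine.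
rewrite -[LHS](iid_exchangeable mZ indep ident s
  (configuration @^-1` [set conf_act s c]) (measurable_configuration _)).
congr (P _); apply/seteqP; split=> w /=; rewrite configuration_perm.
  by move=> /actI.
by move=> ->.
Qed.

Lemma conf_law_ge0 c : 0 <= p c.
Proof. by rewrite fine_ge0. Qed.

(** An event of positive probability is not contained in the exceptional null set. This carries
    almost sure properties over to configurations of positive mass. *)
Lemma conf_law_support (G : Omega -> Prop) c :
  {ae P, forall w, G w} -> p c != 0 -> exists2 w, conf w = c & G w.
Proof.
move=> [B [mB PB0 GB]] pc0; apply: contrapT => noG.
have : (P (conf @^-1` [set c]) <= P B)%E.
  apply: le_measure; rewrite ?inE//; first exact: measurable_conf.
  move=> w wc; apply: GB => Gw; apply: noG; by exists w.
rewrite PB0 => le0; move/eqP: pc0; apply.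
by rewrite /p (_ : P _ = 0%E)//; apply/eqP; rewrite -measure_le0.
Qed.

(** After the exchange argument the bounds hold term by term: a configuration of positive mass comes
    from actual residuals, whose ranks obey [rank_ratio_bounds]. *)
Lemma weighted_miss_bounds (C : {set 'I_N}) (j : 'I_N) (h : {set 'I_N} -> R)
    (alpha : R) : 0 < alpha < 1 -> j \notin C -> (forall S, 0 <= h S) ->
  let M := \sum_c p c * h c.1 * (j \in c.1)%:R *
    (qrank alpha #|C :&: c.1|
      <= #|[set i in C :&: c.1 | (i, j) \in c.2]|)%N%:R in
  M <= \sum_c p c * h c.1 * (j \in c.1)%:R * alpha /\
  ({ae P, forall w, forall i k, i != k -> r (Z i w) != r (Z k w)} ->
   \sum_c p c * h c.1 * (j \in c.1)%:R * (alpha - #|C :&: c.1|.+1%:R^-1) <= M).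
Proof.
move=> a01 jC h0 M; rewrite {}/M (swap_sum _ _ _ _ _ h (qrank alpha) jC conf_law_perm).
(* Putting [k] back into the counted set is harmless, since no residual is strictly below itself. *)
have rankE w c : conf w = c ->
    [set k in j |: C :&: c.1 | (qrank alpha #|C :&: c.1| <=
      #|[set i in (j |: C :&: c.1) :\ k | (i, k) \in c.2]|)%N]%SET =
    [set k in j |: C :&: c.1 | (qrank alpha #|C :&: c.1| <=
      #|[set i in j |: C :&: c.1 | (r (Z i w) < r (Z k w))%R]|)%N]%SET.
  move=> <-; apply/setP => k; rewrite inE [RHS]inE; congr (_ && (_ <= _)%N).
  apply: eq_card => i; rewrite !inE /= !tnth_mktuple.
  by case: eqVneq => [->|]; rewrite ?ltxx ?andbF.
have cardW (S : {set 'I_N}) : #|j |: C :&: S| = #|C :&: S|.+1.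
  by rewrite cardsU1 inE (negbTE jC).
have w0 c : 0 <= p c * h c.1 * (j \in c.1)%:R by rewrite !mulr_ge0 ?conf_law_ge0.
split=> [|distinct]; apply: ler_sum => c _.
- have [->|/(conf_law_support (fun=> True))] := eqVneq (p c) 0; first by rewrite !mul0r.
  case=> [|w /rankE -> _]; first exact: aeW.
  apply: (ler_wpM2l (w0 c)).
  by have [] := rank_ratio_bounds _ _ (fun i => r (Z i w)) _ _ _ a01 (cardW c.1).
- have [->|/(conf_law_support _ _ distinct)] := eqVneq (p c) 0; first by rewrite !mul0r.
  case=> w /rankE -> dw; apply: (ler_wpM2l (w0 c)).
  have [_] := rank_ratio_bounds _ _ (fun i => r (Z i w)) _ _ _ a01 (cardW c.1).
  by apply=> i k _ _ eik; apply/eqP; apply: contraTT isT => /dw; rewrite eik eqxx.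
Qed.

End configuration.

(** * Selection-conditional coverage and the two bounds on the FCR *)

Theorem theorem1 (R : realType) (dO : measure_display) (Omega : measurableType dO)
  (P : probability Omega R) (dim n m : nat)
  (muhat g : dim.-tuple R -> R)
  (C : {set 'I_(n + m)})
  (X : 'I_(n + m) -> Omega -> dim.-tuple R) (Y : 'I_(n + m) -> Omega -> R)
  (tau : (n + m).-tuple R -> R) (alpha : R) :
  measurable_fun setT muhat -> measurable_fun setT g ->
  #|C| = n ->
  (forall i, measurable_fun setT (X i)) -> (forall i, measurable_fun setT (Y i)) ->
  mutually_independent P (fun i w => (X i w, Y i w)) ->
  identically_distributed P (fun i w => (X i w, Y i w)) ->
  measurable_fun setT tau ->
  (forall (s : 'S_(n + m)) (t : (n + m).-tuple R),
      tau [tuple tnth t (s i) | i < n + m] = tau t) ->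
  0 < alpha < 1 ->
  let T := fun i w => g (X i w) in
  let Res := fun i w => `|Y i w - muhat (X i w)| in
  let tauhat := fun w => tau [tuple T i w | i < n + m] in
  let Su := fun w => [set i in ~: C | T i w <= tauhat w] in
  let Sc := fun w => [set i in C | T i w <= tauhat w] in
  let Q := fun w => Qalpha alpha (fun i => Res i w) (Sc w) in
  let miss := fun j w => ~~ in_PI (muhat (X j w)) (Q w) (Y j w) in
  let FCR := (\int[P]_w
      ((#|[set j in Su w | miss j w]|%:R / (maxn #|Su w| 1)%:R)%:E))%E in
  [/\ (forall j, j \in ~: C -> (0 < P [set w | j \in Su w])%E ->
         cond_prob P [set w | miss j w] [set w | j \in Su w] <= alpha),
      (FCR <= alpha%:E)%E &
      ({ae P, forall w, forall i j, i != j -> Res i w != Res j w} ->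
       P [set w | (0 < #|Su w|)%N] = 1%E ->
       (alpha%:E - \int[P]_w (((#|Sc w|.+1)%:R)^-1)%:E <= FCR)%E)].
Proof.
move=> mmu mg _ mX mY indep ident mtau tau_sym a01 T Res tauhat Su Sc Q miss FCR.
have /andP[a0 a1] := a01.
pose Z (i : 'I_(n + m)) (w : Omega) := (X i w, Y i w).
pose gT (z : dim.-tuple R * R) := g z.1.
pose res (z : dim.-tuple R * R) := `|z.2 - muhat z.1|.
have mZ i : measurable_fun setT (Z i) by exact: measurable_fun_pair.
have mgT : measurable_fun setT gT by exact: measurableT_comp.
have mres : measurable_fun setT res.
  apply: measurableT_comp => //; apply: measurable_funB => //.
  exact: measurableT_comp.
(* The selected sets and the misses are now shown to be functions of [conf w] alone. *)
pose conf w := @configuration R _ _ _ gT res tau [tuple Z i w | i < n + m].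
have confS w : (conf w).1 = [set i | T i w <= tauhat w]%SET.
  apply/setP => i; rewrite !inE !tnth_mktuple; congr (_ <= tau _).
  by apply: eq_mktuple => k; rewrite tnth_mktuple.
have SuE w : Su w = ~: C :&: (conf w).1.
  by rewrite confS; apply/setP => i; rewrite !inE.
have ScE w : Sc w = C :&: (conf w).1.
  by rewrite confS; apply/setP => i; rewrite !inE.
pose M j (c : {set 'I_(n + m)} * {set 'I_(n + m) * 'I_(n + m)}) :=
  (qrank alpha #|C :&: c.1| <= #|[set i in C :&: c.1 | (i, j) \in c.2]|)%N.
have missE j w : miss j w = M j (conf w).
  rewrite /miss not_in_PI_Qalpha// ScE /M; congr (_ <= _)%N.
  by apply: eq_card => i; rewrite !inE /= !tnth_mktuple.
pose p c : R := fine (P (conf @^-1` [set c])).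
have mconf c : measurable (conf @^-1` [set c]).
  exact: (measurable_conf mZ mgT mres mtau).
have p0 c : 0 <= p c by rewrite fine_ge0.
have p1 : \sum_c p c = 1.
  have := probability_discrete mconf (P := P) xpredT.
  rewrite (_ : [set w | _] = setT) ?probability_setT; last by apply/seteqP.
  by move=> [] ->; apply: eq_bigr => c _; rewrite mulr1.
pose B := weighted_miss_bounds mZ indep ident mgT mres mtau tau_sym C.
pose v (S : {set 'I_(n + m)}) : R := (maxn #|~: C :&: S| 1)%:R^-1.
have v0 S : 0 <= v S by rewrite invr_ge0.
(* The count of misses is split over the test indices, which gives weighted miss sums with weight
   [v]. *)
have FCRE : FCR = (\sum_(j in ~: C) \sum_c
    p c * v c.1 * (j \in c.1)%:R * (M j c)%:R)%:E.
  pose F (c : {set 'I_(n + m)} * {set 'I_(n + m) * 'I_(n + m)}) : R :=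
    #|[set j in ~: C :&: c.1 | M j c]|%:R * v c.1.
  have F0 c : 0 <= F c by rewrite mulr_ge0.
  rewrite exchange_big/= (eq_bigr (fun c => p c * F c)) => [|c _].
    rewrite -(integral_discrete mconf F F0); apply: eq_integral => w _.
    rewrite SuE /F /v; congr (_%:R / _)%:E; apply: eq_card => j.
    by rewrite !inE missE.
  rewrite /F -sum1dep_card natr_sum mulr_suml mulr_sumr big_mkcond/= [RHS]big_mkcond/=.
  apply: eq_bigr => j _; rewrite !inE; case: (j \in C) => //=.
  by case: (j \in c.1); case: (M j c); rewrite /= ?mulr1 ?mulr0 ?mul0r ?mul1r.
(* Summing the selection indicators over the test indices gives the size of the selected test set,
   hence the factor [#|S_u| / max(#|S_u|, 1)]. *)
have sumU (x : {set 'I_(n + m)} * {set 'I_(n + m) * 'I_(n + m)} -> R) :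
    \sum_(j in ~: C) \sum_c p c * v c.1 * (j \in c.1)%:R * x c =
    \sum_c p c * (#|~: C :&: c.1|%:R * v c.1 * x c).
  rewrite exchange_big/=; apply: eq_bigr => c _.
  rewrite -sum1_card natr_sum 2!mulr_suml mulr_sumr big_mkcond/= [RHS]big_mkcond/=.
  apply: eq_bigr => j _; rewrite !inE; case: (j \in C) => //=.
  by case: (j \in c.1); rewrite ?mulr1 ?mulr0 ?mul0r ?mul1r ?mulrA.
split.
- move=> j jC.
  have -> : [set w | j \in Su w] = [set w | j \in (conf w).1].
    by apply/seteqP; split=> w /=; rewrite SuE finset.in_setI jC.
  rewrite /cond_prob.
  have -> : [set w | miss j w] `&` [set w | j \in (conf w).1] =
      [set w | (j \in (conf w).1) && M j (conf w)].
    by apply/seteqP; split=> w /=; rewrite missE; [move=> []|move=> /andP[]] => -> ->.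
  rewrite (probability_discrete mconf (fun c => j \in c.1)).
  rewrite (probability_discrete mconf (fun c => (j \in c.1) && M j c)) /=.
  rewrite lte_fin => Pj; rewrite ler_pdivrMr//.
  have jC' : j \notin C by rewrite -finset.in_setC.
  (* Unit weight turns the bound into the conditional one, cleared of its denominator. *)
  have [H _] := B j (fun=> 1) alpha a01 jC' (fun=> ler01).
  rewrite mulr_sumr.
  apply: le_trans (le_trans H _).
    by apply: ler_sum => c _; rewrite mulr1 -mulrA -natrM mulnb.
  by apply: ler_sum => c _; rewrite mulr1 mulrC.
- rewrite FCRE lee_fin.
  apply: (@le_trans _ _ (\sum_(j in ~: C) \sum_c
      p c * v c.1 * (j \in c.1)%:R * alpha)).
    apply: ler_sum => j; rewrite inE => jC.
    by have [] := B j v alpha a01 jC v0.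
  (* The factor is at most 1 and the total mass is 1. *)
  rewrite (sumU (fun=> alpha)) -[leRHS]mul1r -[X in _ <= X * _]p1 mulr_suml.
  apply: ler_sum => c _; rewrite ler_wpM2l// ler_piMl// ?(ltW a0)//.
  by rewrite /v ler_pdivrMr ?mul1r ?ler_nat ?ltr0n ?leq_max ?leqnn ?orbT.
- move=> distinct Su1.
  have p_Su0 c : ~: C :&: c.1 = finset.set0 -> p c = 0.
    have := probability_discrete mconf (P := P) (fun c => (0 < #|~: C :&: c.1|)%N).
    rewrite (_ : [set w | _] = [set w | (0 < #|Su w|)%N]); last first.
      by apply/seteqP; split=> w /=; rewrite SuE.
    rewrite Su1 => -[sum1] Su0.
    (* The configurations that select no test index have total mass zero, so each of these
       nonnegative masses vanishes. *)
    have sum0 : \sum_c p c * (#|~: C :&: c.1| == 0)%N%:R = 0.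
      apply: (addrI 1); rewrite {1}sum1 addr0 -big_split -[RHS]p1.
      by apply: eq_bigr => d _ /=; rewrite lt0n; case: (_ == _); rewrite mulr0 mulr1
        ?addr0 ?add0r.
    have := psumr_eq0P _ sum0 => /(_ (fun d _ => mulr_ge0 (p0 d) (ler0n _ _))).
    by move=> /(_ c isT); rewrite Su0 cards0 eqxx mulr1.
  pose x (c : {set 'I_(n + m)} * {set 'I_(n + m) * 'I_(n + m)}) : R :=
    #|C :&: c.1|.+1%:R^-1.
  have -> : (\int[P]_w (#|Sc w|.+1%:R^-1)%:E = (\sum_c p c * x c)%:E)%E.
    rewrite -(integral_discrete mconf x) => [|c]; last by rewrite invr_ge0.
    by apply: eq_integral => w _; rewrite ScE.
  rewrite FCRE -EFinB lee_fin.
  apply: (@le_trans _ _ (\sum_(j in ~: C) \sum_c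
      p c * v c.1 * (j \in c.1)%:R * (alpha - x c))); last first.
    apply: ler_sum => j; rewrite inE => jC.
    by have [_] := B j v alpha a01 jC v0; apply.
  rewrite (sumU (fun c => alpha - x c)) -[X in X - _]mul1r -[X in X * _ - _]p1
    mulr_suml -sumrB.
  apply: ler_sum => c _; rewrite -mulrBr.
  (* For a nonempty selection the factor is exactly 1, so the term is kept whatever the sign of
     [alpha - x c]; an empty selection has no mass. *)
  have [Su0|] := eqVneq (~: C :&: c.1) finset.set0; first by rewrite p_Su0// !mul0r.
  rewrite -card_gt0 => Su_gt0.
  by rewrite /v (maxn_idPl Su_gt0) divff ?mul1r// pnatr_eq0 -lt0n.
Qed.
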